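(* Let $X$ be a first-countable topological space that admits a continuous bijection onto a subspace of an ordinal. Then $X$ admits a continuous bijection onto a first-countable subspace of an ordinal.
   Context: Every ordinal is considered with its order topology, and a subspace of an ordinal is a subset of an ordinal with the subspace topology. The two ordinals (in the hypothesis and in the conclusion) need not be the same. A continuous bijection need not have a continuous inverse. *)

(* Defs.v *)
From mathcomp Require Import all_boot all_order all_classical.
From mathcomp Require wochoice.
From mathcomp Require Import topology.

Set Implicit Arguments.
Unset Strict Implicit.
Unset Printing Implicit Defensive.

Local Open Scope classical_set_scope.

Definition first_countable (T : topologicalType) : Prop :=
  forall x : T, exists B : set (set T),
    [/\ countable B, B `<=` nbhs x &
        forall U, nbhs x U -> exists2 V, B V & V `<=` U].

(* Ordinals are represented, up to order isomorphism, by the well-ordered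
   types; the order topology only depends on the order, and it is part of the
   structure [orderTopologicalType]. *)
Definition is_ordinal d (T : orderTopologicalType d) : Prop :=
  wochoice.well_order (<=%O : rel T).

Definition continuous_bijection (X Y : topologicalType) (f : X -> Y) : Prop :=
  continuous f /\ bijective f.

(* Main.v *)
(* Points that are isolated in X are moved to successor positions: replace
   the ordinal T by T x {0, 1} with the lexicographic order, and send x to
   (f x, 1) if x is isolated in X and to (f x, 0) otherwise.  The points of the
   first kind become isolated in the image.  If x is not isolated, every member
   V of a countable base at x inside f^-1(]-oo, f x]) contains some y_V with
   f y_V < f x; by continuity the points f y_V are cofinal below f x, so that
   the sets ](f y_V, 1), (f x, 0)] form a countable base at the image of x. *)
Require Import Defs.
From mathcomp Require Import all_boot all_order all_classical.
From mathcomp Require wochoice.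
From mathcomp Require Import interval topology.

Set Implicit Arguments.
Unset Strict Implicit.
Unset Printing Implicit Defensive.

Import Order.TTheory.
Local Open Scope order_scope.
Local Open Scope classical_set_scope.

Section WellOrderedSpaces.
Context {d : Order.disp_t} {T : orderTopologicalType d}.

(** A neighbourhood contains an open-ended interval around [x]. Its right end can be ignored, as
    points up to [x] lie below it; the alternatives are an infinite and a finite left end. *)
Lemma nbhs_left_itv (x : T) (U : set T) : nbhs x U ->
  (forall z, z <= x -> U z) \/
  exists2 y, y < x & forall z, y < z <= x -> U z.
Proof.
rewrite itv_nbhsE => -[[l r] [oe +] sub].
rewrite itv_boundlr => /andP[lx xr].
have rP z : z <= x -> (BRight z <= r).
  by move=> zx; apply: le_trans xr; rewrite bnd_simp.
case: l oe lx sub => [[] y|[]] oe lx sub.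
- by case: r oe {xr rP sub} => [[]?|[]].
- right; exists y; first by move: lx; rewrite bnd_simp.
  move=> z /andP[yz zx]; apply: sub => /=.
  by rewrite itv_boundlr rP// bnd_simp yz.
- by left => z zx; apply: sub => /=; rewrite itv_boundlr rP.
- by case: r oe {xr rP sub} lx => [[]?|[]].
Qed.

(** Either [x] is the maximum and the ray is the whole space, or [x] has a successor [m] and the ray
    is everything below [m]. *)
Lemma open_le_ordinal (x : T) : is_ordinal T -> open [set z | z <= x].
Proof.
move=> wo; have [[y xy]|noy] := pselect (exists y, x < y); last first.
  rewrite (_ : [set z | _] = setT); first exact: openT.
  apply/seteqP; split => // z _ /=; rewrite leNgt; apply/negP => xz.
  by apply: noy; exists z.
have [|m [[xm mmin] _]] := wo [pred z | x < z]; first by exists y.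
rewrite (_ : [set z | _] = `]-oo, m[%classic); first exact: lray_open.
apply/seteqP; split => z /=; rewrite in_itv/=.
  by move=> zx; apply: le_lt_trans xm.
by move=> zm; rewrite leNgt; apply: contraL zm => xz; rewrite -leNgt mmin.
Qed.

Lemma nbhs_le_ordinal (x : T) : is_ordinal T -> nbhs x [set z | z <= x].
Proof.
by move=> wo; apply: open_nbhs_nbhs; split => /=; first exact: open_le_ordinal.
Qed.

Lemma nbhs_itvoc_ordinal (x y : T) :
  is_ordinal T -> y < x -> nbhs x [set z | y < z <= x].
Proof.
move=> wo yx; rewrite (_ : [set z | _] = `]y, +oo[ `&` [set z | z <= x]).
  apply: open_nbhs_nbhs; split; last by rewrite /= in_itv/= yx.
  by apply: openI; [exact: rray_open|exact: open_le_ordinal].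
apply/seteqP; split => z /=; rewrite in_itv/= andbT; first by case/andP.
by case=> -> ->.
Qed.

End WellOrderedSpaces.

(** For an ordinal [T] this is the ordinal product 2 · [T]: each point is replaced by two
    consecutive ones. *)
Definition doubling d (T : orderType d) := order_topology (T *lexi[d] bool).

Section Doubling.
Context {d : Order.disp_t} {T : orderTopologicalType d}.

Lemma lt_doubling (a b : T) (i j : bool) :
  (((a, i) : doubling T) < (b, j)) = (a < b) || ((a == b) && (i < j)).
Proof.
transitivity (((a, i) : T *lexi[d] bool) < (b, j)) => //.
by rewrite Order.ProdLexiOrder.ltEprodlexi; case: (ltgtP a b).
Qed.

Lemma doubling_is_ordinal : is_ordinal T -> is_ordinal (doubling T).
Proof.
move=> wo; apply: wochoice.antisymmetric_well_order.
  by move=> x y /andP[xy yx]; apply/eqP; rewrite eq_le xy.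
move=> A [[a i] Aa].
have [|m [[/asboolP[j Amj] mmin] _]] :=
  wo [pred m | `[<exists j, ((m, j) : doubling T) \in A>]].
  by exists a; apply/asboolP; exists i.
(* Over the least first coordinate [m], the second is [false] as soon as [(m, false)] lies in [A],
   and [true] otherwise. *)
exists (m, ((m, false) : doubling T) \notin A); split.
  case: (boolP (((m, false) : doubling T) \in A)) => //= nA.
  by case: j Amj => // Amf; rewrite Amf in nA.
move=> [b k] Abk; rewrite leNgt lt_doubling; apply/negP => /orP[bm|].
  have : m <= b by apply: mmin; apply/asboolP; exists k.
  by rewrite leNgt bm.
by case: k Abk => Abk /andP[/eqP bm]; [case: (_ \in A)|rewrite -bm Abk].
Qed.

(** The point [(x, true)] has the immediate predecessor [(x, false)], and closed initial segments of
    an ordinal are open. *)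
Lemma doubling_isolated (x : T) :
  is_ordinal T -> open [set ((x, true) : doubling T)].
Proof.
move=> /doubling_is_ordinal wo.
rewrite (_ : [set _] =
  `](x, false) : doubling T, +oo[ `&` [set z : doubling T | z <= (x, true)]).
  by apply: openI; [exact: rray_open|exact: open_le_ordinal].
apply/seteqP; split => [_ ->|[z b]] /=.
  by rewrite in_itv/= andbT lt_doubling eqxx ltxx.
rewrite in_itv/= andbT leNgt !lt_doubling => -[+ /negP].
by case: (ltgtP x z) => // ->; case: b.
Qed.

End Doubling.

Section SubspaceTopology.
Context {X T : topologicalType} (A : set T).

Lemma nbhs_set_val (p : set_type A) (V : set T) :
  nbhs (set_val p) V -> nbhs p (set_val @^-1` V).
Proof. by move=> nV; apply: (@initial_continuous _ _ (@set_val T A)). Qed.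

Lemma nbhs_set_typeP (p : set_type A) (U : set (set_type A)) : nbhs p U ->
  exists2 V, nbhs (set_val p) V & set_val @^-1` V `<=` U.
Proof.
rewrite nbhsE => -[_ [[V oV <-] Vp] VU].
by exists V; [exists V|exact: VU].
Qed.

Lemma continuous_into_set_type (f : X -> set_type A) :
  continuous (set_val \o f) -> continuous f.
Proof.
move=> fc x U /nbhs_set_typeP[V nV VU].
have : nbhs x ((set_val \o f) @^-1` V) := fc x V nV.
by rewrite nbhs_simpl; apply: filterS => y Vy; apply: VU.
Qed.

End SubspaceTopology.

Theorem theorem2p3 (X : topologicalType) :
  first_countable X ->
  (exists (d : Order.disp_t) (T : orderTopologicalType d) (A : set T)
     (f : X -> set_type A),
     is_ordinal T /\ continuous_bijection f) ->
  exists (d : Order.disp_t) (T : orderTopologicalType d) (A : set T)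
    (f : X -> set_type A),
    [/\ is_ordinal T, first_countable (set_type A) & continuous_bijection f].
Proof.
move=> fcX [d [T [A [f [wo [fc fbij]]]]]].
pose g x : T := set_val (f x).
have gc : continuous g.
  move=> x; apply: continuous_comp; first exact: fc.
  exact: initial_continuous.
have ginj : injective g by move=> x y /val_inj/(bij_inj fbij).
pose h x : doubling T := (g x, `[<open [set x]>]).
have hinj : injective h by move=> x y [/ginj].
pose h' x : set_type (range h) := SigSub (mem_set (imageT h x)).
have hval x : set_val (h' x) = h x by [].
have hsurj p : exists x, p = h' x.
  by have [x _ hx] := set_valP p; exists x; apply: val_inj; rewrite -hx.
(* Otherwise all points of [N] with image at most [g x] would, by injectivity of [g], equal [x], and
   [x] would be isolated. *)
have smaller x N : ~ open [set x] -> nbhs x N -> exists2 y, N y & g y < g x.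
  move=> nix nN; have nW : nbhs x [set z | N z /\ g z <= g x].
    by apply: filterI => //; exact: (gc x _ (nbhs_le_ordinal _ wo)).
  apply: contrapT => noy; apply: nix.
  rewrite openE => _ ->; apply: filterS nW => z [Nz zx].
  apply/ginj/eqP; rewrite eq_le zx leNgt; apply/negP => lt_zx.
  by apply: noy; exists z.
exists _, (doubling T), (range h), h'; split.
- exact: doubling_is_ordinal.
- move=> p; have [x ->] := hsurj p.
  have [ix|nix] := pselect (open [set x]).
    exists [set [set h' x]]; split; first exact: countable1.
      move=> _ ->; have hx : h x = (g x, true) by rewrite /h asboolT.
      have : nbhs (set_val (h' x)) [set (g x, true)].
        by rewrite hval hx; apply: open_nbhs_nbhs; split => //;
          exact: doubling_isolated.
      move/nbhs_set_val; apply: filterS => q /= qx.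
      by apply: val_inj; rewrite -[LHS]/(set_val q) qx -hx.
    move=> U /nbhs_singleton Ux; exists [set h' x] => //.
    by move=> _ ->.
  have hx : h x = (g x, false) by rewrite /h asboolF.
  have [B [cB Bx Bbase]] := fcX x.
  (* The default [x] is never returned when [V] is a neighbourhood of [x], by [smaller]. *)
  pose y V := xget x [set z | V z /\ g z < g x].
  have yP V : nbhs x V -> V (y V) /\ g (y V) < g x.
    by move=> /(smaller _ _ nix)[z Vz zx];
      apply: (@xgetPex _ x [set z | V z /\ g z < g x]); exists z.
  pose W V : set (set_type (range h)) :=
    set_val @^-1` [set t | ((g (y V), true) : doubling T) < t <= h x].
  exists [set W V | V in B]; split.
  + exact: (sub_countable (card_image_le _ _)).
  + move=> _ [V BV <-]; have [_ yx] := yP V (Bx V BV).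
    apply/nbhs_set_val/nbhs_itvoc_ordinal; first exact: doubling_is_ordinal.
    by rewrite hval hx lt_doubling yx.
  + move=> U /nbhs_set_typeP[U' /nbhs_left_itv U'nbhs U'U].
    (* It is enough that all points of some neighbourhood [N] with image below [g x] are good left
       endpoints: a basic [V] inside [N] then puts [y V] in [N]. *)
    suff [N nN NU'] : exists2 N, nbhs x N & forall z, N z -> g z < g x ->
        forall t, ((g z, true) : doubling T) < t <= h x -> U' t.
      have [V BV VN] := Bbase _ nN; have [/VN Vy yx] := yP V (Bx V BV).
      exists (W V); first by exists V.
      by move=> q qW; apply: U'U; apply: NU' qW.
    case: U'nbhs => [le_U'|[[m i]]].
      exists setT; first exact: filterT.
      by move=> z _ _ t /andP[_ tx]; apply: le_U'.
    (* Nothing lies below [false], so [(m, i) < (g x, false)] forces [m < g x], and continuity of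
       [g] applies to the interval from [m] to [g x]. *)
    rewrite hval hx lt_doubling ltx0 andbF orbF => mx mU'.
    exists [set z | m < g z <= g x].
      exact: (gc x _ (nbhs_itvoc_ordinal wo mx)).
    move=> z /andP[mz _] _ t /andP[zt tx]; apply: mU'; rewrite tx andbT.
    by apply: lt_trans zt; rewrite lt_doubling mz.
- split.
    suff hc : continuous h by exact: continuous_into_set_type.
    move=> x U.
    (* Continuity of [h] is automatic at isolated points, so the jump to the second copy does no
       harm there. *)
    have [ix /nbhs_singleton Ux|nix] := pselect (open [set x]).
      have : nbhs x [set x] by apply: open_nbhs_nbhs.
      by rewrite nbhs_simpl; apply: filterS => _ ->.
    have hx : h x = (g x, false) by rewrite /h asboolF.
    move=> /nbhs_left_itv Unbhs.
    suff [N nN NU] : exists2 N, nbhs x N & forall z, N z -> U (h z).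
      by rewrite nbhs_simpl; apply: filterS nN => z /NU.
    (* The labels could only matter when [g z = g x], and then [z = x]. *)
    have le_hx z : g z <= g x -> h z <= h x.
      rewrite le_eqVlt => /orP[/eqP/ginj->//|zx].
      by apply: ltW; rewrite lt_doubling zx.
    case: Unbhs => [le_U|[[m i]]].
      exists [set z | g z <= g x]; last by move=> z /le_hx/le_U.
      exact: (gc x _ (nbhs_le_ordinal _ wo)).
    rewrite hx lt_doubling ltx0 andbF orbF => mx mU.
    exists [set z | m < g z <= g x].
      exact: (gc x _ (nbhs_itvoc_ordinal wo mx)).
    move=> z /andP[mz zx]; apply: mU; rewrite -hx le_hx// andbT.
    by rewrite lt_doubling mz.
  rewrite -setTT_bijective; split => //.
    by move=> x y _ _ /(congr1 set_val); rewrite !hval => /hinj.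
  by move=> p _; have [x ->] := hsurj p; exists x.
Qed.
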